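(* Let $L\ge2$ be the number of classes, let $T,\Delta_S,B_W>0$, and let $D$ be a positive integer (the packet length) such that $$K_{\mathsf{ms}}=\left\lfloor\frac{T}{\Delta_S}-\frac{D}{B_W\Delta_S}\right\rfloor\ \ge\ 1 .$$ Let $\rho=\xi_a(1-\varepsilon)$ be the successful transmission probability, and let $\overline{E}_{\mathsf{ms}}$ be the sensing accuracy for multi-snapshot sensing with $K=K_{\mathsf{ms}}$ snapshots, that is, $$\overline{E}_{\mathsf{ms}}=\frac{\rho}{L}\sum_{\ell=1}^L\Pr(\hat\ell=\ell\mid\ell,K_{\mathsf{ms}})+\frac{1-\rho}{L}.$$ Then $$\overline{E}_{\mathsf{ms}}\ \ge\ (L-1)\,\rho\,\max\left\{0,\ \frac1L-Q\!\left(\frac{\sqrt{K_{\mathsf{ms}}\,g_{\min}}}{2}\right)\right\}+\frac1L .$$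
   Context: $Q(x)=\frac{1}{\sqrt{2\pi}}\int_x^\infty e^{-t^2/2}\,dt$. Data and classifier: $\boldsymbol{\mu}_1,\dots,\boldsymbol{\mu}_L\in\mathbb{R}^N$ are class centroids and $\mathbf{C}=\mathrm{diag}(C_{1,1},\dots,C_{N,N})$ with all $C_{n,n}>0$. Given the ground-truth class $\ell$, the $K$ snapshots give independent feature vectors $\mathbf{x}_1,\dots,\mathbf{x}_K\sim\mathcal{N}(\boldsymbol{\mu}_\ell,\mathbf{C})$, which are fused into $\overline{\mathbf{x}}=\frac1K\sum_{k=1}^K\mathbf{x}_k$. The estimated class is $\hat\ell=\operatorname{argmin}_{\ell'}(\overline{\mathbf{x}}-\boldsymbol{\mu}_{\ell'})^{\mathsf T}\mathbf{C}^{-1}(\overline{\mathbf{x}}-\boldsymbol{\mu}_{\ell'})$, and $\Pr(\hat\ell=\ell\mid\ell,K)$ is the probability of correct classification with $K$ snapshots when the true class is $\ell$. Put $g_{\ell,\ell'}=(\boldsymbol{\mu}_\ell-\boldsymbol{\mu}_{\ell'})^{\mathsf T}\mathbf{C}^{-1}(\boldsymbol{\mu}_\ell-\boldsymbol{\mu}_{\ell'})$ and $g_{\min}=\min_{\ell\ne\ell'}g_{\ell,\ell'}$. Transmission: $\xi_a\in[0,1]$ is the activation probability of the sensor and the decoding error probability is $\varepsilon=Q\left(\ln(2)\sqrt{\frac{D}{V}}\left(\log_2(1+\gamma)-\frac{NQ_B}{D}\right)\right)$ with $\gamma>0$ the SNR, $V=1-(1+\gamma)^{-2}$, and $Q_B>0$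 the number of quantization bits per feature. Deadline: each snapshot takes time $\Delta_S$ and transmission takes time $D/B_W$ ($B_W$ is the bandwidth); $K_{\mathsf{ms}}$ is the largest number $K$ of snapshots with $K\Delta_S+D/B_W\le T$, where $T$ is the task completion deadline. The term $(1-\rho)/L$ in $\overline{E}_{\mathsf{ms}}$ accounts for random guessing upon transmission failure. *)

(* Defs.v *)
From HB Require Import structures.
From mathcomp Require Import all_boot all_order all_algebra.
From mathcomp Require Import all_classical all_reals all_analysis.

Set Implicit Arguments.
Unset Strict Implicit.
Unset Printing Implicit Defensive.

Import Order.TTheory GRing.Theory Num.Theory.
Import numFieldNormedType.Exports.

Local Open Scope classical_set_scope.
Local Open Scope ring_scope.

Fact cV_display : measure_display.
Proof. exact: default_measure_display. Qed.

Section measurable_cV.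
Context (R : realType) (N : nat).

Definition cV_coord (n : 'I_N) (v : 'cV[R]_N) : measurableTypeR R := v n 0.

Let cV_set0 : g_sigma_preimage cV_coord set0.
Proof. exact: sigma_algebra0. Qed.

Let cV_setC A : g_sigma_preimage cV_coord A -> g_sigma_preimage cV_coord (~` A).
Proof. exact: sigma_algebraC. Qed.

Let cV_bigcup (F : (set 'cV[R]_N)^nat) :
  (forall i, g_sigma_preimage cV_coord (F i)) ->
  g_sigma_preimage cV_coord (\bigcup_i (F i)).
Proof. exact: sigma_algebra_bigcup. Qed.

(* The Borel sigma-algebra of R^N, generated by the coordinate maps, as for
   tuples. *)
HB.instance Definition _ := @isMeasurable.Build cV_display
  'cV[R]_N (g_sigma_preimage cV_coord) cV_set0 cV_setC cV_bigcup.

End measurable_cV.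

Section multivariate_normal.
Context (R : realType).

(* Integral of a nonnegative function on R^N against N-dimensional Lebesgue
   measure, which the library does not provide, in Tonelli's iterated form:
   int_R ... int_R f(v_0, ..., v_(N-1)) dv_(N-1) ... dv_0. *)
Fixpoint integral_cV (N : nat) : ('cV[R]_N -> \bar R) -> \bar R :=
  match N with
  | 0 => fun f => f 0
  | N'.+1 => fun f =>
      (\int[lebesgue_measure]_(t in [set: measurableTypeR R])
         integral_cV (fun v : 'cV[R]_N' =>
           f (col_mx (t%:M : 'cV[R]_1) v : 'cV[R]_N'.+1)))%E
  end.

(* The quadratic form (u - v)^T C^-1 (u - v), whose value is a 1 x 1 matrix. *)
Definition mahalanobis N (C : 'M[R]_N) (u v : 'cV[R]_N) : R :=
  ((u - v)^T *m invmx C *m (u - v)) 0 0.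

Definition mvnormal_pdf N (m : 'cV[R]_N) (C : 'M[R]_N) (v : 'cV[R]_N) : R :=
  (Num.sqrt ((2 * pi) ^+ N * \det C))^-1 * expR (- (mahalanobis C v m / 2)).

(* X ~ N(m, C) under P, for a symmetric positive definite C. *)
Definition is_mvnormal d (T : measurableType d) (P : probability T R) N
    (X : {mfun T >-> 'cV[R]_N}) (m : 'cV[R]_N) (C : 'M[R]_N) : Prop :=
  forall A : set 'cV[R]_N, measurable A ->
    P (X @^-1` A) = integral_cV (fun v => (\1_A v * mvnormal_pdf m C v)%:E).

Definition mutually_independent d (T : measurableType d) (P : probability T R)
    N K (X : 'I_K -> {mfun T >-> 'cV[R]_N}) : Prop :=
  forall (J : {set 'I_K}) (A : 'I_K -> set 'cV[R]_N),
    (forall k, measurable (A k)) ->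
    P (\bigcap_(k in [set` J]) X k @^-1` A k) =
      (\prod_(k in J) P (X k @^-1` A k))%E.

End multivariate_normal.

Section classifier.
Context (R : realType).

Definition fused d (T : measurableType d) N K
    (X : 'I_K -> {mfun T >-> 'cV[R]_N}) (w : T) : 'cV[R]_N :=
  K%:R^-1 *: \sum_(k < K) X k w.

(* The value of argmin_l (v - mu_l)^T C^-1 (v - mu_l) is not unique when v is
   equidistant from several nearest centroids; any Borel choice of a minimizer
   is accepted as a classifier. *)
Definition is_argmin_classifier N L (mu : 'I_L -> 'cV[R]_N) (C : 'M[R]_N)
    (lhat : 'cV[R]_N -> 'I_L) : Prop :=
  (forall l, measurable (lhat @^-1` [set l])) /\
  (forall v l', mahalanobis C v (mu (lhat v)) <= mahalanobis C v (mu l')).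

Definition prob_correct d (T : measurableType d) (P : probability T R) N L K
    (X : 'I_K -> {mfun T >-> 'cV[R]_N}) (lhat : 'cV[R]_N -> 'I_L) (l : 'I_L)
    : R :=
  fine (P [set w | lhat (fused X w) = l]).

(* The value is finite as soon as L >= 2. *)
Definition g_min N L (mu : 'I_L -> 'cV[R]_N) (C : 'M[R]_N) : R :=
  fine (\big[Order.min/+oo%E]_(p : 'I_L * 'I_L | p.1 != p.2)
          (mahalanobis C (mu p.1) (mu p.2))%:E).

End classifier.

Section transmission.
Context (R : realType).

Definition gaussQ (x : R) : R :=
  (Num.sqrt (2 * pi))^-1 *
  \int[lebesgue_measure]_(t in `[x, +oo[) expR (- (t ^+ 2 / 2)).

Definition log2 (x : R) : R := ln x / ln 2.

Definition dispersion (gamma : R) : R := 1 - (1 + gamma) ^- 2.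

Definition decoding_error (N D : nat) (QB gamma : R) : R :=
  gaussQ (ln 2 * Num.sqrt (D%:R / dispersion gamma) *
          (log2 (1 + gamma) - N%:R * QB / D%:R)).

Definition success_prob (xi : R) (N D : nat) (QB gamma : R) : R :=
  xi * (1 - decoding_error N D QB gamma).

Definition K_ms (T DS BW : R) (D : nat) : int :=
  Num.floor (T / DS - D%:R / (BW * DS)).

Definition sensing_accuracy (rho : R) (L : nat) (pc : 'I_L -> R) : R :=
  rho / L%:R * (\sum_(l < L) pc l) + (1 - rho) / L%:R.

End transmission.

(* Main.v *)
(* Stack the K snapshots into a vector z of K N independent real Gaussians,
   whose law is determined by its values on boxes.  Up to a term that does not
   depend on m, the exponent of its density for the centroid m is
   K mahalanobis(barycenter z, m), so the argmin rule is the maximum likelihood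
   rule.  Two lower bounds on the average accuracy follow:
   - on the region where the rule answers l, the density under class l
     dominates the one under any fixed class, and the regions cover the space,
     so the L accuracies sum to at least 1;
   - preferring l' to l is a half-space event for z, of probability
     Q(sqrt(K g_{l,l'}) / 2) under class l if g_{l,l'} > 0, so the union bound
     applies.
   When Q(sqrt(K g_min) / 2) >= 1/L the first bound is enough; otherwise
   g_min > 0, because Q(0) >= 1/2, and the second one applies. *)

From HB Require Import structures.
Require Import Defs.
From mathcomp Require Import all_boot all_order all_algebra.
From mathcomp Require Import all_classical all_reals all_analysis.
From mathcomp Require Import measurable_realfun ring lra.

Set Implicit Arguments.
Unset Strict Implicit.
Unset Printing Implicit Defensive.

Import Order.TTheory GRing.Theory Num.Theory.
Import numFieldNormedType.Exports.

Local Open Scope classical_set_scope.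
Local Open Scope ring_scope.

(** * Measurability and uniqueness of measures on column vectors *)

Section measurable_column_vectors.
Context (R : realType).

Lemma measurable_cV_coord N (n : 'I_N) :
  measurable_fun [set: 'cV[R]_N] (cV_coord n).
Proof.
move=> _ Y mY; rewrite setTI; apply: sub_sigma_algebra => /=.
rewrite -bigcup_seq/=; exists n => /=; first by rewrite mem_index_enum.
by exists Y => //; rewrite setTI.
Qed.

(** The coordinates generate the sigma-algebra, so its preimage under [f] is generated by the
    preimages under the functions [cV_coord n \o f]. *)
Lemma measurable_fun_cV d (T : measurableType d) N (f : T -> 'cV[R]_N) :
  (forall n, measurable_fun [set: T] (cV_coord n \o f)) ->
  measurable_fun [set: T] f.
Proof.
move=> mf _ A mA; rewrite setTI.
suff: g_sigma_preimage (fun n => @cV_coord R N n \o f) `<=` measurable.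
  by apply; rewrite g_sigma_preimage_comp; exists A => //; rewrite setTI.
apply: smallest_sub; first exact: sigma_algebra_measurable.
rewrite -bigcup_seq; apply: bigcup_sub => n _ /= _ [B mB <-].
exact: mf.
Qed.

Definition cV_rect N (B : 'I_N -> set (measurableTypeR R)) : set 'cV[R]_N :=
  [set v | forall n, B n (cV_coord n v)].

Lemma measurable_cV_rect N (B : 'I_N -> set (measurableTypeR R)) :
  (forall n, measurable (B n)) -> measurable (cV_rect B).
Proof.
move=> mB.
rewrite (_ : cV_rect B = \big[setI/setT]_(n < N) (cV_coord n @^-1` B n)).
  apply: bigsetI_measurable => n _; rewrite -[X in measurable X]setTI.
  exact: measurable_cV_coord.
rewrite -bigcap_seq; apply/seteqP; split => [v vB n _|v vB n]; first exact: vB.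
by apply: (vB n); rewrite /= mem_index_enum.
Qed.

Lemma cV_rectI N (B B' : 'I_N -> set (measurableTypeR R)) :
  cV_rect B `&` cV_rect B' = cV_rect (fun n => B n `&` B' n).
Proof.
apply/seteqP; split => [v [vB vB'] n|v vB]; first by split.
by split => n; have [] := vB n.
Qed.

Definition cV_rects N : set (set 'cV[R]_N) :=
  [set A | exists2 B, (forall n, measurable (B n)) & A = cV_rect B].

Lemma measurable_cVE N : @measurable _ 'cV[R]_N = <<s @cV_rects N >>.
Proof.
apply/seteqP; split; last first.
  apply: smallest_sub; first exact: sigma_algebra_measurable.
  by move=> _ [B mB ->]; exact: measurable_cV_rect.
apply: smallest_sub; first exact: smallest_sigma_algebra.
rewrite -bigcup_seq; apply: bigcup_sub => n _ /= _ [B mB <-].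
(* A cylinder over coordinate [n] is a box whose other sides are the whole line. *)
apply: sub_sigma_algebra; exists (fun i => if i == n then B else setT).
  by move=> i; case: ifP.
rewrite setTI; apply/seteqP; split => [v vB i|v /(_ n)]; last by rewrite eqxx.
by case: ifPn => // /eqP ->.
Qed.

(** Boxes are stable under intersection, generate the sigma-algebra and include the whole space;
    since [m1] is finite, the constant sequence [setT] serves as the exhausting sequence. *)
Lemma cV_measure_unique N (m1 m2 : {measure set 'cV[R]_N -> \bar R}) :
  (m1 setT < +oo)%E ->
  (forall B, (forall n, measurable (B n)) -> m1 (cV_rect B) = m2 (cV_rect B)) ->
  forall A, measurable A -> m1 A = m2 A.
Proof.
move=> m1T m12; apply: (measure_unique (@cV_rects N) (fun=> setT)) => //.
- exact: measurable_cVE.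
- move=> _ _ [B mB ->] [B' mB' ->]; rewrite cV_rectI.
  by exists (fun n => B n `&` B' n) => // n; exact: measurableI.
- by move=> _; exists (fun=> setT) => //; apply/seteqP; split.
- by rewrite bigcup_const//; exists 0%N.
- by move=> _ [B mB ->]; exact: m12.
Qed.

(** Taking a pair makes this a map out of a product space, to which Tonelli applies; the vector
    built is the one in the recursion of [integral_cV]. *)
Definition cV_cons N (tv : measurableTypeR R * 'cV[R]_N) : 'cV[R]_N.+1 :=
  col_mx (tv.1%:M : 'cV[R]_1) tv.2.

Lemma cV_cons0 N (tv : measurableTypeR R * 'cV[R]_N) :
  cV_cons tv ord0 0 = tv.1.
Proof.
rewrite /cV_cons (_ : ord0 = lshift N (0 : 'I_1)); last exact: val_inj.
by rewrite (@col_mxEu _ 1) mxE eqxx.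
Qed.

Lemma cV_consS N (tv : measurableTypeR R * 'cV[R]_N) (n : 'I_N) :
  cV_cons tv (lift ord0 n) 0 = tv.2 n 0.
Proof.
rewrite /cV_cons (_ : lift ord0 n = rshift 1 n); last exact: val_inj.
by rewrite (@col_mxEd _ 1).
Qed.

Lemma measurable_cV_cons N :
  measurable_fun [set: measurableTypeR R * 'cV[R]_N] (@cV_cons N).
Proof.
apply: measurable_fun_cV => n; have [i ->|->] := unliftP ord0 n.
  rewrite (_ : _ \o _ = cV_coord i \o snd); last first.
    by apply/funext => tv /=; rewrite /cV_coord cV_consS.
  exact: measurableT_comp (measurable_cV_coord i) measurable_snd.
rewrite (_ : _ \o _ = fst); first exact: measurable_fst.
by apply/funext => tv /=; rewrite /cV_coord cV_cons0.
Qed.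

Definition cV_behead N (v : 'cV[R]_N.+1) : 'cV[R]_N :=
  \col_n v (lift ord0 n) 0.

Lemma measurable_cV_behead N :
  measurable_fun [set: 'cV[R]_N.+1] (@cV_behead N).
Proof.
apply: measurable_fun_cV => n.
rewrite (_ : _ \o _ = cV_coord (lift ord0 n)); first exact: measurable_cV_coord.
by apply/funext => v /=; rewrite /cV_coord mxE.
Qed.

End measurable_column_vectors.

(** * Laws with independent coordinates, and Tonelli for them *)

Section product_law.
Context (R : realType).

(** Independence of the coordinates is a property of a given [G], checked on boxes. Boxes determine
    a probability, so no product measure on column vectors has to be built. *)
Definition product_law N (G : set 'cV[R]_N -> \bar R)
    (mu : 'I_N -> probability (measurableTypeR R) R) : Prop :=
  forall B, (forall n, measurable (B n)) ->
    G (cV_rect B) = (\prod_(n < N) mu n (B n))%E.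

Lemma product_law_unique N (G1 G2 : probability 'cV[R]_N R) mu :
  product_law G1 mu -> product_law G2 mu ->
  forall A, measurable A -> G1 A = G2 A.
Proof.
move=> G1mu G2mu; apply: cV_measure_unique.
  by rewrite -[X in (X < _)%E]/(G1 setT) probability_setT ltry.
by move=> B mB; exact: etrans (G1mu B mB) (esym (G2mu B mB)).
Qed.

(** The witness [G'] is the law of the tail under [G]. The image of [mu ord0 \x G'] under [cV_cons]
    agrees with [G] on boxes, hence everywhere, and Tonelli on the product gives the iterated
    integral. *)
Lemma product_law_Fubini N (G : probability 'cV[R]_N.+1 R)
    (mu : 'I_N.+1 -> probability (measurableTypeR R) R) :
  product_law G mu ->
  exists2 G' : probability 'cV[R]_N R,
    product_law G' (fun n => mu (lift ord0 n)) &
    forall f : 'cV[R]_N.+1 -> \bar R, measurable_fun [set: 'cV[R]_N.+1] f ->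
      (forall v, 0 <= f v)%E ->
      (\int[G]_v f v = \int[mu ord0]_t \int[G']_v f (cV_cons (t, v)))%E.
Proof.
move=> Gmu.
pose tl : {mfun 'cV[R]_N.+1 >-> 'cV[R]_N} :=
  HB.pack (@cV_behead R N) (isMeasurableFun.Build _ _ _ _ _
    (@measurable_cV_behead R N)).
pose cons : {mfun (measurableTypeR R * 'cV[R]_N)%type >-> 'cV[R]_N.+1} :=
  HB.pack (@cV_cons R N) (isMeasurableFun.Build _ _ _ _ _
    (@measurable_cV_cons R N)).
have G'mu : product_law (distribution G tl) (fun n => mu (lift ord0 n)).
  move=> B mB.
  (* The tail lies in a box when the whole vector lies in that box extended by the full line in
     coordinate 0, a side of mass 1. *)
  pose B' n := if unlift ord0 n is Some i then B i else setT.
  have mB' n : measurable (B' n) by rewrite /B'; case: unliftP.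
  have := Gmu _ mB'; rewrite big_ord_recl {2}/B' unlift_none probability_setT.
  under eq_bigr do rewrite /B' liftK.
  rewrite mul1e => <-; congr (G _); apply/seteqP; split => [v vB n|v vB n].
    rewrite /B'; case: unliftP => // i ->; have := vB i.
    by rewrite /cV_coord mxE.
  by have := vB (lift ord0 n); rewrite /B' liftK /cV_coord mxE.
exists (distribution G tl) => // f mf f0.
have GE : forall A, measurable A ->
    G A = distribution (mu ord0 \x distribution G tl)%E cons A.
  apply: product_law_unique Gmu _ => B mB.
  rewrite -[LHS]/((mu ord0 \x distribution G tl)%E (cons @^-1` cV_rect B)).
  rewrite (_ : _ @^-1` _ = B ord0 `*` cV_rect (fun n => B (lift ord0 n))).
    rewrite product_measure1E//; last exact: measurable_cV_rect.
    by rewrite [X in (_ * X)%E]G'mu// big_ord_recl.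
  apply/seteqP; split => [[t v] tvB|[t v] [/= tB vB] n].
    split => [|n] /=; first by have := tvB ord0; rewrite /cV_coord cV_cons0.
    by have := tvB (lift ord0 n); rewrite /cV_coord cV_consS.
  by have [i ->|->] := unliftP ord0 n; rewrite /cV_coord ?cV_consS ?cV_cons0.
transitivity (\int[distribution (mu ord0 \x distribution G tl) cons]_v f v)%E.
  by apply: eq_measure_integral => A mA _; exact: GE.
rewrite ge0_integral_distribution//.
rewrite fubini_tonelli1//=.
exact: measurableT_comp mf (@measurable_cV_cons R N).
Qed.

Lemma cV0_integral (G : probability 'cV[R]_0 R) (f : 'cV[R]_0 -> \bar R) :
  (\int[G]_v f v = f 0%R)%E.
Proof.
under eq_integral do rewrite [X in f X]flatmx0.
by rewrite integral_cst// [X in (_ * X)%E]probability_setT mule1.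
Qed.

End product_law.

(** * Integration against a measure with a density *)

Section density.
Local Open Scope ereal_scope.
Context d (T : measurableType d) (R : realType).
Variables (mu nu : {measure set T -> \bar R}) (h : T -> R).
Hypothesis mh : measurable_fun setT h.
Hypothesis h0 : forall x, (0 <= h x)%R.
Hypothesis nuE : forall A, measurable A -> nu A = \int[mu]_(x in A) (h x)%:E.

Import HBNNSimple.

(** Monotone convergence along simple functions increasing to [f] reduces the claim to indicators,
    where it is [nuE]. *)
Lemma ge0_integral_density (f : T -> \bar R) :
  measurable_fun [set: T] f -> (forall x, 0 <= f x) ->
  \int[nu]_x f x = \int[mu]_x (f x * (h x)%:E).
Proof.
move=> mf f0; pose g := nnsfun_approx measurableT mf.
have mhE : measurable_fun setT (EFin \o h) by exact/measurable_EFinP.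
have gf x : (EFin \o g n) x @[n --> \oo] --> f x.
  by apply: cvg_nnsfun_approx => // y _; exact: f0.
have -> : \int[nu]_x f x = lim (\int[nu]_x (EFin \o g n) x @[n --> \oo]).
  under eq_integral => x _ do rewrite -(cvg_lim _ (gf x))//.
  apply: monotone_convergence => //.
  - by move=> n; exact/measurable_EFinP.
  - by move=> n x _; rewrite lee_fin.
  - by move=> x _ a b ab; rewrite lee_fin; exact/lefP/nd_nnsfun_approx.
have -> : \int[mu]_x (f x * (h x)%:E) =
    lim (\int[mu]_x ((EFin \o g n) x * (h x)%:E) @[n --> \oo]).
  have gfh x : (EFin \o g n) x * (h x)%:E @[n --> \oo] --> f x * (h x)%:E.
    by apply: cvgeZr.
  under eq_integral => x _ do rewrite -(cvg_lim _ (gfh x))//.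
  apply: monotone_convergence => //.
  - by move=> n; apply: emeasurable_funM => //; exact/measurable_EFinP.
  - by move=> n x _; rewrite mule_ge0 ?lee_fin.
  - move=> x _ a b ab; rewrite lee_wpmul2r ?lee_fin//.
    exact/lefP/nd_nnsfun_approx.
suff gE n : \int[mu]_x ((EFin \o g n) x * (h x)%:E) =
    \int[nu]_x (EFin \o g n) x by under eq_fun do rewrite -gE.
have mgn r :
    measurable_fun [set: T] (fun x => (r * \1_(g n @^-1` [set r]) x)%:E).
  by apply/measurable_EFinP; exact: measurable_funM.
transitivity (\int[nu]_x
    (\sum_(y \in range (g n)) (y * \1_(g n @^-1` [set y]) x)%:E)); last first.
  by apply: eq_integral => t _; rewrite /= fimfunE -fsumEFin.
rewrite ge0_integral_fsum//; last by move=> r x _; exact: nnfun_muleindic_ge0.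
transitivity (\int[mu]_x (\sum_(y \in range (g n))
    (y * \1_(g n @^-1` [set y]) x)%:E * (h x)%:E)).
  apply: eq_integral => x _.
  rewrite -ge0_mule_fsuml => [|y]; last exact: nnfun_muleindic_ge0.
  by rewrite fsumEFin // -(fimfunE _ x).
rewrite ge0_integral_fsum//; last 2 first.
  - by move=> y; apply: emeasurable_funM.
  - by move=> r x _; rewrite mule_ge0 ?lee_fin//; exact: nnfun_muleindic_ge0.
apply: eq_fsbigr => r; rewrite inE => -[t _ gtr].
have r0 : (0 <= r)%R by rewrite -gtr.
under eq_integral do rewrite EFinM -muleA.
rewrite ge0_integralZl//; last 2 first.
  - apply: emeasurable_funM => //; exact/measurable_EFinP.
  - by move=> x _; rewrite mule_ge0 ?lee_fin.
under [RHS]eq_integral do rewrite EFinM.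
rewrite ge0_integralZl//; last exact/measurable_EFinP.
congr (_ * _); rewrite integral_indic// setIT nuE//.
rewrite [RHS]integral_mkcond; apply: eq_integral => x _.
by rewrite epatch_indic/= muleC.
Qed.

End density.

(** * Affine change of variables for Lebesgue measure *)

Section affine_change_of_variables.
Local Open Scope ereal_scope.
Context (R : realType).
Local Notation leb := (@lebesgue_measure R).

Let affine (a b : R) : measurableTypeR R -> measurableTypeR R :=
  fun x => (a * x + b)%R.

Let measurable_affine a b : measurable_fun setT (affine a b).
Proof. by apply: measurable_funD => //; exact: measurable_funM. Qed.

(** The right-hand side is a measure in [A], so it is enough to compare it with Lebesgue measure on
    half-open intervals. *)
Let lebesgue_measure_affine (a b : R) (A : set (measurableTypeR R)) :
  a != 0%R -> measurable A -> leb A = `|a|%:E * leb (affine a b @^-1` A).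
Proof.
move=> a0 mA.
pose m : {measure set (measurableTypeR R) -> \bar R} :=
  mscale (NngNum (normr_ge0 a)) (pushforward leb (affine a b)).
rewrite -[RHS]/(m (measurable_affine a b) A).
apply: lebesgue_measure_unique => // _ [[u v] _ <-] /=.
rewrite -[RHS]/(`|a|%:E * leb (affine a b @^-1` `]u, v])).
have [a_gt0|a_lt0|a_eq0] := ltrgt0P a; last by rewrite a_eq0 eqxx in a0.
  rewrite (_ : _ @^-1` _ = `](u - b) / a, (v - b) / a]%classic)%R; last first.
    apply/seteqP; split => x /=; rewrite !in_itv /affine/=;
      by rewrite ltr_pdivrMr// ler_pdivlMr// ltrBlDr lerBrDr mulrC.
  rewrite !lebesgue_measure_itv/= !lte_fin ltr_pM2r ?invr_gt0// ltrD2r.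
  case: ifPn => _; rewrite ?mule0// -!EFinB -EFinM; congr EFin.
  by field; rewrite gt_eqF.
(* A negative slope exchanges the endpoints, and with them the closed and the open side. *)
rewrite (_ : _ @^-1` _ = `[(v - b) / a, (u - b) / a[%classic)%R; last first.
  apply/seteqP; split => x /=; rewrite !in_itv /affine/=;
    by rewrite ltr_ndivlMr// ler_ndivrMr// ltrBlDr lerBrDr mulrC andbC.
rewrite !lebesgue_measure_itv/= !lte_fin ltr_nM2r ?invr_lt0// ltrD2r.
case: ifPn => _; rewrite ?mule0// -!EFinB -EFinM; congr EFin.
by field; rewrite lt_eqF.
Qed.

Lemma ge0_integral_affine (f : measurableTypeR R -> \bar R) (a b : R) :
  a != 0%R -> measurable_fun setT f -> (forall x, 0 <= f x) ->
  \int[leb]_x f x = `|a|%:E * \int[leb]_x f (a * x + b)%R.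
Proof.
move=> a0 mf f0.
pose m : {measure set (measurableTypeR R) -> \bar R} :=
  mscale (NngNum (normr_ge0 a)) (pushforward leb (affine a b)).
transitivity (\int[m (measurable_affine a b)]_x f x).
  by apply: eq_measure_integral => A mA _; exact: lebesgue_measure_affine.
by rewrite ge0_integral_mscale//= ge0_integral_pushforward.
Qed.

End affine_change_of_variables.

(** * Affine images and convolution of normal laws *)

Section normal_probability.
Local Open Scope ereal_scope.
Context (R : realType).
Local Notation leb := (@lebesgue_measure R).
Implicit Types (m s a b x : R) (f : measurableTypeR R -> \bar R).

(** The density depends on [s] only through its square. Affine maps of negative slope produce such
    negative deviations. *)
Lemma normal_probN (m s : R) : normal_prob m (- s) = normal_prob m s.
Proof.
rewrite /normal_prob; apply/funext => A; apply: eq_integral => x _.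
by rewrite /normal_pdf oppr_eq0 /normal_peak /normal_fun sqrrN.
Qed.

Lemma ge0_integral_normal m s f :
  measurable_fun setT f -> (forall x, 0 <= f x) ->
  \int[normal_prob m s]_x f x = \int[leb]_x (f x * (normal_pdf m s x)%:E).
Proof.
move=> mf f0; apply: ge0_integral_density => //.
- exact: measurable_normal_pdf.
- exact: normal_pdf_ge0.
Qed.

Lemma normal_pdf_affine m s a b x : s != 0%R -> a != 0%R ->
  normal_pdf (a * m + b) (a * s) (a * x + b) = (`|a|^-1 * normal_pdf m s x)%R.
Proof.
move=> s0 a0; rewrite !normal_pdfE ?mulf_neq0//.
rewrite mulrA; congr (_ * _)%R.
  rewrite /normal_peak exprMn -mulrA -mulrnAr sqrtrM ?sqr_ge0// sqrtr_sqr.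
  by rewrite invfM.
rewrite /normal_fun; congr expR.
by field; rewrite a0 s0.
Qed.

Lemma ge0_integral_normal_affine m s a b f :
  s != 0%R -> a != 0%R -> measurable_fun setT f -> (forall x, 0 <= f x) ->
  \int[normal_prob m s]_x f (a * x + b)%R =
  \int[normal_prob (a * m + b) (a * s)]_x f x.
Proof.
move=> s0 a0 mf f0.
have maff : measurable_fun [set: measurableTypeR R] (fun x => a * x + b)%R.
  by apply: measurable_funD => //; exact: measurable_funM.
have mpdf m' s' :
    measurable_fun [set: measurableTypeR R] (fun x => (normal_pdf m' s' x)%:E).
  by apply/measurable_EFinP; exact: measurable_normal_pdf.
have pdf0 m' s' x : 0 <= (normal_pdf m' s' x)%:E.
  by rewrite lee_fin normal_pdf_ge0.
apply: etrans
  (ge0_integral_normal _ _ (measurableT_comp mf maff) (fun=> f0 _)) _.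
apply: etrans (esym (ge0_integral_normal _ _ mf f0)).
rewrite [RHS](@ge0_integral_affine _ _ a b)//; last 2 first.
- by apply: emeasurable_funM => //; exact: mpdf.
- by move=> x; rewrite mule_ge0.
rewrite -ge0_integralZl//; last 2 first.
- apply: emeasurable_funM; first exact: measurableT_comp mf maff.
  exact: measurableT_comp (mpdf _ _) maff.
- by move=> x _; rewrite mule_ge0.
apply: eq_integral => x _; rewrite normal_pdf_affine// muleCA; congr (_ * _).
by rewrite -EFinM mulrA divff ?mul1r// normr_eq0.
Qed.

(* Completing the square in t: the product of the densities of X at t and of
   Y at u - t is the density of X + Y at u times that of X given X + Y = u. *)
Lemma normal_pdfM s1 s2 t u : s1 != 0%R -> s2 != 0%R ->
  let s := Num.sqrt (s1 ^+ 2 + s2 ^+ 2) in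
  (normal_pdf 0 s1 t * normal_pdf 0 s2 (u - t) =
   normal_pdf 0 s u * normal_pdf (s1 ^+ 2 / s ^+ 2 * u) (s1 * s2 / s) t)%R.
Proof.
move=> s10 s20 s.
have s2E : (s ^+ 2 = s1 ^+ 2 + s2 ^+ 2)%R.
  by rewrite sqr_sqrtr// addr_ge0// sqr_ge0.
have s_gt0 : (0 < s)%R.
  by rewrite sqrtr_gt0 ltr_wpDr ?sqr_ge0// exprn_even_gt0.
have s0 : s != 0%R by rewrite gt_eqF.
rewrite !normal_pdfE ?mulf_neq0 ?invr_eq0//.
rewrite mulrACA [RHS]mulrACA; congr (_ * _)%R.
  rewrite /normal_peak -!invfM; congr (_^-1)%R.
  have v0 (r : R) : (0 <= r ^+ 2 * pi *+ 2)%R.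
    by rewrite mulrn_wge0// mulr_ge0 ?sqr_ge0// pi_ge0.
  rewrite -!sqrtrM//.
  by congr Num.sqrt; field.
rewrite /normal_fun -!expRD; congr expR.
have -> : (s2 ^+ 2 = s ^+ 2 - s1 ^+ 2)%R by rewrite s2E addrC addKr.
rewrite !expr_div_n exprMn.
have -> : (s2 ^+ 2 = s ^+ 2 - s1 ^+ 2)%R by rewrite s2E addrC addKr.
field.
rewrite s10 s0/= s2E addrC addKr.
by rewrite andbT sqrf_eq0.
Qed.

(** Convolution of two centred normal laws: substitute u = x + y, exchange the integrals, and factor
    the joint density by [normal_pdfM]; the conditional density then integrates to 1. *)
Lemma ge0_integral_normalD s1 s2 f : s1 != 0%R -> s2 != 0%R ->
  measurable_fun setT f -> (forall x, 0 <= f x) ->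
  \int[normal_prob 0 s1]_x \int[normal_prob 0 s2]_y f (x + y)%R =
  \int[normal_prob 0 (Num.sqrt (s1 ^+ 2 + s2 ^+ 2))]_z f z.
Proof.
move=> s10 s20 mf f0; set s := Num.sqrt _.
have mpdf m' s' :
    measurable_fun [set: measurableTypeR R] (fun x => (normal_pdf m' s' x)%:E).
  by apply/measurable_EFinP; exact: measurable_normal_pdf.
have pdf0 m' s' x : 0 <= (normal_pdf m' s' x)%:E.
  by rewrite lee_fin normal_pdf_ge0.
have madd : measurable_fun [set: measurableTypeR R * measurableTypeR R]
    (fun p => p.1 + p.2)%R by exact: measurable_funD.
have maddl x : measurable_fun [set: measurableTypeR R] (fun y => x + y)%R.
  exact: measurable_funD.
have msub : measurable_fun [set: measurableTypeR R * measurableTypeR R]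
    (fun p => p.2 - p.1)%R.
  by apply: measurable_funB.
(* [F] is [f] of the sum times the joint density of the first variable and the sum. *)
pose F (p : measurableTypeR R * measurableTypeR R) : \bar R :=
  f p.2 * ((normal_pdf 0 s1 p.1)%:E * (normal_pdf 0 s2 (p.2 - p.1))%:E).
have mF : measurable_fun setT F.
  apply: emeasurable_funM; first exact: measurableT_comp mf measurable_snd.
  apply: emeasurable_funM.
    exact: measurableT_comp (mpdf _ _) measurable_fst.
  exact: measurableT_comp (mpdf 0%R s2) msub.
have F0 p : 0 <= F p by rewrite !mule_ge0.
have inner x : \int[normal_prob 0 s2]_y f (x + y)%R * (normal_pdf 0 s1 x)%:E =
    \int[leb]_u F (x, u).
  rewrite ge0_integral_normal//; last exact: measurableT_comp mf (maddl x).
  rewrite -ge0_integralZr//; last 2 first.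
  - apply: emeasurable_funM => //; exact: measurableT_comp mf (maddl x).
  - by move=> y _; rewrite mule_ge0.
  rewrite [RHS](@ge0_integral_affine _ _ 1 x)//; last first.
    exact: measurableT_comp mF (pair1_measurable x).
  rewrite normr1 mul1e; apply: eq_integral => y _; rewrite /F/= mul1r addrK.
  by rewrite (addrC y) -muleA (muleC (normal_pdf 0 s2 y)%:E).
rewrite ge0_integral_normal; last 2 first.
- exact: (measurable_fun_fubini_tonelli_F _
      (measurableT_comp mf madd) (fun=> f0 _)).
- by move=> x; apply: integral_ge0.
under eq_integral do rewrite inner.
rewrite (fubini_tonelli F mF F0).
rewrite ge0_integral_normal//; apply: eq_integral => u _.
rewrite /F/=.
under eq_integral do rewrite -EFinM normal_pdfM// EFinM muleA.
rewrite ge0_integralZl//; last by rewrite mule_ge0.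
by rewrite [X in _ * X]integral_normal_pdf mule1.
Qed.

End normal_probability.

(** * The Gaussian tail function *)

Section gaussQ.
Context (R : realType).
Implicit Types x y : R.

Lemma gaussQE x : (gaussQ x)%:E = normal_prob 0 1 `[x, +oo[%classic.
Proof.
have pk : normal_peak 1 = (Num.sqrt (2 * pi))^-1 :> R.
  by rewrite /normal_peak expr1n mul1r mulr_natl.
have -> : gaussQ x = fine (normal_prob 0 1 `[x, +oo[%classic).
  have -> : normal_prob 0 1 `[x, +oo[%classic =
      (\int[lebesgue_measure]_(t in `[x, +oo[)
        ((Num.sqrt (2 * pi))^-1%:E * (expR (- (t ^+ 2 / 2)))%:E))%E.
    apply: eq_integral => t _.
    rewrite normal_pdfE ?oner_eq0// pk EFinM /normal_fun.
    by rewrite subr0 expr1n mulNr.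
  rewrite ge0_integralZl_EFin//; last first.
    apply/measurable_EFinP/measurable_funTS.
    apply: measurableT_comp => //; apply: measurableT_comp => //.
    by apply: measurable_funM => //; exact: exprn_measurable.
  (* The real integral is a [fine], which sends infinite values to 0. The positive factor preserves
     infinities, so both sides agree in those cases too. *)
  rewrite /gaussQ /Rintegral; case: (integral _ _ _) => [r| |] //=.
  - by rewrite gt0_muley ?mulr0// lte_fin invr_gt0 sqrtr_gt0 mulr_gt0// pi_gt0.
  - by rewrite gt0_muleNy ?mulr0// lte_fin invr_gt0 sqrtr_gt0 mulr_gt0// pi_gt0.
by rewrite fineK// fin_num_measure.
Qed.

Lemma gaussQ_le1 x : gaussQ x <= 1.
Proof. by rewrite -lee_fin gaussQE probability_le1. Qed.

Lemma le_gaussQ x y : x <= y -> gaussQ y <= gaussQ x.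
Proof.
move=> xy; rewrite -lee_fin !gaussQE le_measure ?inE//.
by apply: subset_itvr; rewrite bnd_simp.
Qed.

(** The two closed half-lines have equal mass by symmetry and together cover the line; subadditivity
    makes their overlap at 0 harmless. *)
Lemma gaussQ0_ge : 2^-1 <= gaussQ (0 : R).
Proof.
have symE : normal_prob 0 1 `]-oo, (0 : R)]%classic = (gaussQ 0)%:E.
  rewrite gaussQE -(setIT `]-oo, _]%classic) -(setIT `[_, +oo[%classic).
  rewrite -!integral_indic//.
  have mind : measurable_fun [set: measurableTypeR R]
      (fun x => (\1_`[0, +oo[%classic x : R)%:E).
    by apply/measurable_EFinP.
  (* Reflection, of slope -1, turns the deviation into -1, which gives the same law by
     [normal_probN]. *)
  have := @ge0_integral_normal_affine R 0 1 (-1) 0 _ _ _ mind.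
  rewrite oner_eq0 oppr_eq0 oner_eq0 mulr0 addr0 mulr1 normal_probN => <-//.
  apply: eq_integral => t _; congr EFin; rewrite !indicE !mem_setE.
  by rewrite !in_itv/= mulN1r addr0 andbT oppr_ge0.
have : (1%:E <= normal_prob 0%R 1%R `]-oo, 0%R : R]%classic +
             normal_prob 0%R 1%R `[0%R : R, +oo[%classic)%E.
  rewrite -[leLHS](probability_setT (normal_prob (0 : R) 1)).
  apply: le_trans (measureU2 _ _ _) => //.
  rewrite le_measure ?inE//; first exact: measurableU.
  by move=> t _ /=; rewrite !in_itv/= andbT; exact/orP/le_total.
by rewrite symE -gaussQE -EFinD lee_fin; lra.
Qed.

End gaussQ.

(** * The law of an affine functional of independent normal variables *)

Section gaussian_linear_functional.
Local Open Scope ereal_scope.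
Context (R : realType).
Implicit Types (f : measurableTypeR R -> \bar R).

Lemma ge0_integral_normal_scale (s m : R) f : s != 0%R ->
  measurable_fun setT f -> (forall x, 0 <= f x) ->
  \int[normal_prob m s]_x f x = \int[normal_prob 0 1]_x f (s * x + m)%R.
Proof.
move=> s0 mf f0.
have := @ge0_integral_normal_affine R 0 1 s m f (oner_neq0 _) s0 mf f0.
by rewrite !mulr0 !add0r !mulr1 => ->.
Qed.

Lemma ge0_integral_normal_abs (s : R) f :
  measurable_fun setT f -> (forall x, 0 <= f x) ->
  \int[normal_prob 0 1]_x f (`|s| * x)%R = \int[normal_prob 0 1]_x f (s * x)%R.
Proof.
move=> mf f0; have [//|s_lt0] := ger0P s.
have s0 : s != 0%R by rewrite lt_eqF.
have := ge0_integral_normal_scale 0 s0 mf f0.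
rewrite -[X in normal_prob 0 X]opprK normal_probN.
have Ns0 : (- s)%R != 0%R by rewrite oppr_eq0.
move/(etrans (esym (ge0_integral_normal_scale 0 Ns0 mf f0))).
under eq_integral do rewrite addr0.
by under [X in _ = X]eq_integral do rewrite addr0.
Qed.

(** Scaling by [a] and by [b] reduces this to the convolution of two normal laws. A zero coefficient
    is treated apart, because the convolution requires nonzero deviations; the square root is then
    an absolute value, removed by symmetry. *)
Lemma ge0_integral_normal2 (a b : R) f :
  measurable_fun setT f -> (forall x, 0 <= f x) ->
  \int[normal_prob 0 1]_x \int[normal_prob 0 1]_y f (a * x + b * y)%R =
  \int[normal_prob 0 1]_z f (Num.sqrt (a ^+ 2 + b ^+ 2) * z)%R.
Proof.
move=> mf f0.
have cst_int (e : \bar R) : \int[normal_prob 0 1]_x e = e.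
  by rewrite integral_cst// [X in _ * X]probability_setT mule1.
have [->|a0] := eqVneq a 0%R.
  rewrite expr0n add0r sqrtr_sqr (@ge0_integral_normal_abs _ f)//.
  rewrite -[RHS]cst_int; apply: eq_integral => x _.
  by apply: eq_integral => y _; rewrite mul0r add0r.
have [->|b0] := eqVneq b 0%R.
  rewrite expr0n addr0 sqrtr_sqr (@ge0_integral_normal_abs _ f)//.
  apply: eq_integral => x _; rewrite -[RHS]cst_int.
  by apply: eq_integral => y _; rewrite mul0r addr0.
have madd : measurable_fun [set: measurableTypeR R * measurableTypeR R]
    (fun p => p.1 + p.2)%R by exact: measurable_funD.
have maddl x : measurable_fun [set: measurableTypeR R] (fun y => x + y)%R.
  exact: measurable_funD.
have inner x : \int[normal_prob 0 1]_y f (x + b * y)%R =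
    \int[normal_prob 0 b]_y f (x + y)%R.
  apply/esym; apply: etrans (@ge0_integral_normal_scale b 0
    (fun y => f (x + y)%R) b0 (measurableT_comp mf (maddl x)) (fun=> f0 _)) _.
  by under eq_integral do rewrite addr0.
under eq_integral do rewrite inner.
pose g x := \int[normal_prob 0 b]_y f (x + y)%R.
transitivity (\int[normal_prob 0 a]_x g x).
  have mg : measurable_fun [set: measurableTypeR R] g.
    exact: (measurable_fun_fubini_tonelli_F _
      (measurableT_comp mf madd) (fun=> f0 _)).
  have g0 x : 0 <= g x by exact: integral_ge0.
  apply/esym; apply: etrans (@ge0_integral_normal_scale a 0 g a0 mg g0) _.
  by apply: eq_integral => x _; rewrite addr0.
apply: etrans (@ge0_integral_normalD _ a b f a0 b0 mf f0) _.
set s := Num.sqrt _.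
have s0 : s != 0%R.
  by rewrite gt_eqF// sqrtr_gt0 ltr_wpDr ?sqr_ge0// exprn_even_gt0.
apply: etrans (@ge0_integral_normal_scale s 0 f s0 mf f0) _.
by under eq_integral do rewrite addr0.
Qed.

(** Induction on [N]: integrate out the tail, then merge its normal variable with the first
    coordinate. Writing the result as a scaled standard normal keeps the statement meaningful when
    the variance is 0, as it is for [N = 0]. *)
Lemma ge0_integral_product_normal N (G : probability 'cV[R]_N R)
    (m s a : 'I_N -> R) (c : R) f :
  (forall n, s n != 0%R) -> product_law G (fun n => normal_prob (m n) (s n)) ->
  measurable_fun setT f -> (forall x, 0 <= f x) ->
  \int[G]_v f (c + \sum_(n < N) a n * v n 0)%R =
  \int[normal_prob 0 1]_z f (c + \sum_(n < N) a n * m n +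
    Num.sqrt (\sum_(n < N) (a n * s n) ^+ 2) * z)%R.
Proof.
move=> + + mf f0; elim: N => [|N IHN] in G m s a c * => s0 Gms.
  rewrite cV0_integral !big_ord0 sqrtr0.
  under [RHS]eq_integral do rewrite mul0r addr0.
  by rewrite integral_cst// [X in _ * X]probability_setT mule1.
have [G' G'ms GE] := product_law_Fubini Gms.
have mfun : measurable_fun [set: 'cV[R]_N.+1]
    (fun v => f (c + \sum_(n < N.+1) a n * v n 0)%R).
  apply: measurableT_comp mf _; apply: measurable_funD => //.
  apply: measurable_sum => n; apply: measurable_funM => //.
  exact: measurable_cV_coord.
apply: etrans (GE _ mfun (fun=> f0 _)) _.
set a' := fun n => a (lift ord0 n); set m' := fun n => m (lift ord0 n).
set s' := fun n => s (lift ord0 n).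
set M := (\sum_(n < N) a' n * m' n)%R.
set S := Num.sqrt (\sum_(n < N) (a' n * s' n) ^+ 2).
(* All constants go into [g], which leaves a centred combination of two variables as its
   argument. *)
pose g u := f (c + a ord0 * m ord0 + M + u)%R.
have mg : measurable_fun [set: measurableTypeR R] g.
  by apply: measurableT_comp mf _; exact: measurable_funD.
transitivity (\int[normal_prob (m ord0) (s ord0)]_t \int[normal_prob 0 1]_z
    g (a ord0 * (t - m ord0) + S * z)%R).
  apply: eq_integral => t _.
  under eq_integral => v _.
    rewrite big_ord_recl cV_cons0/= addrA.
    under eq_bigr do rewrite cV_consS/=.
    over.
  apply: etrans (IHN G' m' s' a' _ (fun=> s0 _) G'ms) _.
  apply: eq_integral => z _; rewrite /g.
  by congr f; rewrite -/M -/S; ring.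
pose h t := \int[normal_prob 0 1]_z g (a ord0 * (t - m ord0) + S * z)%R.
have mh : measurable_fun [set: measurableTypeR R] h.
  have mlin : measurable_fun [set: measurableTypeR R * measurableTypeR R]
      (fun p => a ord0 * (p.1 - m ord0) + S * p.2)%R.
    apply: measurable_funD; apply: measurable_funM => //.
    exact: measurable_funB.
  exact: (measurable_fun_fubini_tonelli_F _
    (measurableT_comp mg mlin) (fun=> f0 _)).
have h0 t : 0 <= h t by apply: integral_ge0 => z _; exact: f0.
apply: etrans (@ge0_integral_normal_scale _ (m ord0) h (s0 ord0) mh h0) _.
rewrite /h; under eq_integral => x _ do rewrite addrK mulrA.
apply: etrans (@ge0_integral_normal2 _ _ g mg (fun=> f0 _)) _.
apply: eq_integral => z _; rewrite /g !big_ord_recl !addrA.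
by rewrite sqr_sqrtr// sumr_ge0// => n _; rewrite sqr_ge0.
Qed.

End gaussian_linear_functional.

(** * Densities between two product laws *)

Section product_law_density.
Local Open Scope ereal_scope.
Context (R : realType).

(** Induction on [N]: Tonelli splits off the first coordinate under both laws, the one-dimensional
    density rule treats it, and the induction hypothesis treats the tail. *)
Lemma product_law_density N (G G' : probability 'cV[R]_N R)
    (mu nu : 'I_N -> probability (measurableTypeR R) R)
    (h : 'I_N -> measurableTypeR R -> R) (f : 'cV[R]_N -> \bar R) :
  (forall n, measurable_fun setT (h n)) -> (forall n x, (0 <= h n x)%R) ->
  (forall n A, measurable A -> nu n A = \int[mu n]_(x in A) (h n x)%:E) ->
  product_law G mu -> product_law G' nu ->
  measurable_fun [set: 'cV[R]_N] f -> (forall v, 0 <= f v) ->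
  \int[G']_v f v = \int[G]_v (f v * (\prod_(n < N) h n (v n 0))%:E).
Proof.
elim: N => [|N IHN] in G G' mu nu h f *; move=> mh h0 nuE Gmu G'nu mf f0.
  by rewrite !cV0_integral big_ord0 mule1.
have [H Hmu GE] := product_law_Fubini Gmu.
have [H' H'nu G'E] := product_law_Fubini G'nu.
pose p (v : 'cV[R]_N.+1) := (\prod_(n < N.+1) h n (v n 0))%R : R.
have p0 (v : 'cV[R]_N.+1) : (0 <= p v)%R by apply: prodr_ge0.
have mp : measurable_fun [set: 'cV[R]_N.+1] p.
  apply: measurable_prod => n _.
  exact: measurableT_comp (mh n) (measurable_cV_coord n).
have mfp : measurable_fun [set: 'cV[R]_N.+1] (fun v => f v * (p v)%:E).
  by apply: emeasurable_funM => //; exact/measurable_EFinP.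
have fp0 (v : 'cV[R]_N.+1) : 0 <= f v * (p v)%:E by rewrite mule_ge0 ?lee_fin.
apply: etrans (G'E f mf f0) _; apply/esym; apply: etrans (GE _ mfp fp0) _.
pose q (v : 'cV[R]_N) := (\prod_(n < N) h (lift ord0 n) (v n 0))%R : R.
have q0 (v : 'cV[R]_N) : (0 <= q v)%R by apply: prodr_ge0.
have mq : measurable_fun [set: 'cV[R]_N] q.
  apply: measurable_prod => n _.
  exact: measurableT_comp (mh _) (measurable_cV_coord n).
have mfcons : measurable_fun setT (f \o @cV_cons R N).
  exact: measurableT_comp mf (@measurable_cV_cons R N).
have mft t : measurable_fun setT (fun v => f (cV_cons (t, v))).
  exact: measurableT_comp mfcons (pair1_measurable t).
pose F t := \int[H']_v f (cV_cons (t, v)).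
have mF : measurable_fun setT F.
  exact: (measurable_fun_fubini_tonelli_F _ mfcons (fun=> f0 _)).
have F0 t : 0 <= F t by apply: integral_ge0.
apply: etrans
  (esym (ge0_integral_density (mh ord0) (h0 ord0) (nuE ord0) mF F0)).
apply: eq_integral => t _; rewrite /F.
have -> : \int[H']_v f (cV_cons (t, v)) =
    \int[H]_v (f (cV_cons (t, v)) * (q v)%:E).
  exact: (IHN H H' _ _ _ (fun v => f (cV_cons (t, v))) (fun=> mh _)
    (fun=> h0 _) (fun=> nuE _) Hmu H'nu (mft t) (fun=> f0 _)).
rewrite -ge0_integralZr ?lee_fin//; last 2 first.
- by apply: emeasurable_funM => //; exact/measurable_EFinP.
- by move=> v _; rewrite mule_ge0 ?lee_fin.
apply: eq_integral => v _; rewrite -muleA -EFinM /p /q big_ord_recl cV_cons0/=.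
by under eq_bigr do rewrite cV_consS/=; rewrite mulrC.
Qed.

End product_law_density.

(** * Normal vectors with diagonal covariance have independent normal coordinates *)

Section mvnormal_rectangles.
Context (R : realType).

Lemma integral_cV_prod N (g : 'I_N -> measurableTypeR R -> R) (k : R) :
  (forall n, measurable_fun setT (g n)) -> (forall n x, 0 <= g n x) -> 0 <= k ->
  integral_cV (fun v : 'cV[R]_N => (k * \prod_(n < N) g n (v n 0))%:E) =
  (k%:E * \prod_(n < N) \int[lebesgue_measure]_x (g n x)%:E)%E.
Proof.
elim: N => [|N IHN] in g k *; move=> mg g0 k0.
  by rewrite /= !big_ord0 mulr1 mule1.
rewrite /= big_ord_recl.
pose c := (\prod_(n < N) \int[lebesgue_measure]_x (g (lift ord0 n) x)%:E)%E.
have c0 : (0 <= c)%E.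
  by apply: prode_ge0 => n _; apply: integral_ge0 => x _; rewrite lee_fin.
have mg0 : measurable_fun setT (fun x => (g ord0 x)%:E).
  exact/measurable_EFinP.
transitivity (\int[lebesgue_measure]_(t in [set: measurableTypeR R])
    (k%:E * ((g ord0 t)%:E * c)))%E.
  apply: eq_integral => t _.
  rewrite muleA -EFinM /c -IHN ?mulr_ge0//.
  congr integral_cV; apply/funext => v; rewrite big_ord_recl mulrA.
  rewrite -[col_mx _ _]/(cV_cons (t, v)) cV_cons0.
  by under eq_bigr do rewrite cV_consS.
rewrite ge0_integralZl//=; last 2 first.
- exact: emeasurable_funM.
- by move=> x _; rewrite mule_ge0 ?lee_fin.
by rewrite ge0_integralZr// => x _; rewrite lee_fin.
Qed.

Variables (N : nat) (C : 'M[R]_N).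
Hypothesis Cdiag : is_diag_mx C.
Hypothesis Cpos : forall n, 0 < C n n.

Lemma mahalanobis_diag (u v : 'cV[R]_N) :
  mahalanobis C u v = \sum_(n < N) (u n 0 - v n 0) ^+ 2 / C n n.
Proof.
pose dC : 'rV[R]_N := \row_n C n n.
have CE : C = diag_mx dC.
  apply/matrixP => i j; rewrite !mxE; have [->|ij] := eqVneq i j.
    by rewrite mulr1n.
  by rewrite mulr0n; move/is_diag_mxP : Cdiag => ->.
have CV : invmx C = diag_mx (\row_n (C n n)^-1).
  have CCV : C *m diag_mx (\row_n (C n n)^-1) = 1%:M.
    rewrite {1}CE mulmx_diag -diag_const_mx; congr diag_mx.
    by apply/rowP => n; rewrite !mxE divff// gt_eqF.
  have [Cu _] := mulmx1_unit CCV.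
  by rewrite -[RHS](mulKmx Cu) CCV mulmx1.
rewrite /mahalanobis CV mxE; apply: eq_bigr => n _.
rewrite mul_mx_diag !mxE; ring.
Qed.

Lemma mvnormal_pdf_diag (m v : 'cV[R]_N) :
  mvnormal_pdf m C v =
  \prod_(n < N) normal_pdf (m n 0) (Num.sqrt (C n n)) (v n 0).
Proof.
have s0 n : Num.sqrt (C n n) != 0 by rewrite gt_eqF// sqrtr_gt0.
have sE n : Num.sqrt (C n n) ^+ 2 = C n n by rewrite sqr_sqrtr// ltW.
under eq_bigr do rewrite normal_pdfE//.
rewrite big_split/= -expR_sum /mvnormal_pdf; congr (_ * expR _).
  rewrite /normal_peak prodfV; congr (_^-1).
  have -> : (2 * pi) ^+ N * \det C =
      \prod_(n < N) (Num.sqrt (C n n) ^+ 2 * pi *+ 2).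
    rewrite det_trig ?is_diag_mx_is_trig//.
    rewrite -[X in _ ^+ X]card_ord -prodr_const -big_split/=.
    by apply: eq_bigr => n _; rewrite sE -mulr_natr; ring.
  have v0 n : 0 <= Num.sqrt (C n n) ^+ 2 * pi *+ 2.
    by rewrite mulrn_wge0// mulr_ge0 ?sqr_ge0// pi_ge0.
  elim/big_rec2: _ => [|n x y _ <-]; first by rewrite sqrtr1.
  by rewrite sqrtrM.
rewrite mahalanobis_diag mulr_suml -sumrN; apply: eq_bigr => n _.
rewrite sE -mulr_natr; field.
by rewrite gt_eqF.
Qed.

(** Both the indicator of a box and the density for a diagonal covariance are products over
    coordinates, so the iterated integral factors. *)
Lemma is_mvnormal_rect d (T : measurableType d) (P : probability T R)
    (X : {mfun T >-> 'cV[R]_N}) (m : 'cV[R]_N)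
    (B : 'I_N -> set (measurableTypeR R)) :
  is_mvnormal P X m C -> (forall n, measurable (B n)) ->
  P (X @^-1` cV_rect B) =
    (\prod_(n < N) normal_prob (m n 0%R) (Num.sqrt (C n n)) (B n))%E.
Proof.
move=> XmC mB; rewrite XmC; last exact: measurable_cV_rect.
pose g n x := \1_(B n) x * normal_pdf (m n 0) (Num.sqrt (C n n)) x : R.
rewrite (_ : (fun _ => _) =
    (fun v : 'cV[R]_N => (1 * \prod_(n < N) g n (v n 0))%:E)); last first.
  apply/funext => v; congr EFin; rewrite mul1r big_split/= -mvnormal_pdf_diag.
  congr (_ * _); rewrite indicE.
  have [/set_mem vB|vB] := boolP (v \in cV_rect B).
    by rewrite big1// => n _; rewrite indicE mem_set//; exact: vB.
  apply/esym/eqP; rewrite prodf_seq_eq0.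
  apply/hasP; move: vB; rewrite notin_setE => /existsNP[n vBn].
  by exists n; rewrite ?mem_index_enum//= indicE memNset.
have mpdf n : measurable_fun [set: measurableTypeR R]
    (normal_pdf (m n 0) (Num.sqrt (C n n))) by exact: measurable_normal_pdf.
rewrite integral_cV_prod//.
- rewrite mul1e; apply: eq_bigr => n _.
  rewrite /normal_prob [RHS]integral_mkcond; apply: eq_integral => x _.
  by rewrite epatch_indic/= /g EFinM muleC.
- by move=> n; apply: measurable_funM => //; exact: measurable_indic.
- by move=> n x; rewrite mulr_ge0 ?normal_pdf_ge0.
Qed.

End mvnormal_rectangles.

(** * Half-spaces and likelihood comparison for Gaussian vectors; stacking of snapshots *)

Section gaussian_vectors.
Context (R : realType).

Lemma measurable_halfspace N (a : 'I_N -> R) (c : R) :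
  measurable [set v : 'cV[R]_N | 0 <= c + \sum_(n < N) a n * v n 0].
Proof.
pose l (v : 'cV[R]_N) : measurableTypeR R := c + \sum_(n < N) a n * v n 0.
have ml : measurable_fun setT l.
  apply: measurable_funD => //; apply: measurable_sum => n.
  by apply: measurable_funM => //; exact: measurable_cV_coord.
rewrite (_ : mkset _ = l @^-1` `[0, +oo[).
  by rewrite -[X in measurable X]setTI; exact: ml.
by apply/seteqP; split => v /=; rewrite in_itv/= andbT.
Qed.

Lemma normal_product_halfspace N (G : probability 'cV[R]_N R)
    (m s a : 'I_N -> R) (c : R) :
  (forall n, s n != 0) -> product_law G (fun n => normal_prob (m n) (s n)) ->
  let S := \sum_(n < N) (a n * s n) ^+ 2 in 0 < S ->
  G [set v | 0 <= c + \sum_(n < N) a n * v n 0] =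
  (gaussQ (- (c + \sum_(n < N) a n * m n) / Num.sqrt S))%:E.
Proof.
move=> s0 Gms S S_gt0.
pose f (x : measurableTypeR R) : \bar R := (\1_`[0%R, +oo[%classic x : R)%:E.
have mf : measurable_fun setT f.
  by apply/measurable_EFinP; exact: measurable_indic.
have f0 x : (0 <= f x)%E by rewrite lee_fin.
have := ge0_integral_product_normal a c s0 Gms mf f0.
rewrite (_ : (fun v => f _) = fun v : 'cV[R]_N =>
    (\1_[set v | 0 <= c + \sum_(n < N) a n * v n 0] v : R)%:E); last first.
  apply/funext => v; rewrite /f !indicE; congr (_ *+ nat_of_bool _)%:E.
  by apply/idP/idP; rewrite !inE/= in_itv/= andbT.
rewrite integral_indic//; last exact: measurable_halfspace.
rewrite setIT => ->; have S0 : 0 < Num.sqrt S by rewrite sqrtr_gt0.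
rewrite gaussQE -[in RHS](setIT `[_, +oo[%classic) -integral_indic//.
apply: eq_integral => x _; rewrite /f !indicE; congr (_ *+ nat_of_bool _)%:E.
apply/idP/idP; rewrite !inE/= !in_itv/= !andbT -/S.
  by rewrite ler_pdivrMr// => H; lra.
by rewrite ler_pdivrMr// => H; lra.
Qed.

(** The likelihood ratio of [G'] to [G] is the exponential of half the difference between the sums
    of squares for [m] and for [m'], hence at least 1 on [A]. *)
Lemma le_normal_product N (G G' : probability 'cV[R]_N R)
    (m m' s : 'I_N -> R) (A : set 'cV[R]_N) :
  (forall n, s n != 0) ->
  product_law G (fun n => normal_prob (m n) (s n)) ->
  product_law G' (fun n => normal_prob (m' n) (s n)) ->
  measurable A ->
  (forall v, A v -> \sum_(n < N) (v n 0 - m' n) ^+ 2 / s n ^+ 2 <=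
                    \sum_(n < N) (v n 0 - m n) ^+ 2 / s n ^+ 2) ->
  (G A <= G' A)%E.
Proof.
move=> s0 Gm G'm' mA Am.
have pdf_gt0 k n x : 0 < normal_pdf k (s n) x.
  by rewrite normal_pdfE// mulr_gt0 ?expR_gt0// normal_peak_gt0.
pose h n (x : measurableTypeR R) :=
  normal_pdf (m' n) (s n) x / normal_pdf (m n) (s n) x.
have hE n x : h n x =
    expR (((x - m n) ^+ 2 / s n ^+ 2 - (x - m' n) ^+ 2 / s n ^+ 2) / 2).
  rewrite /h !normal_pdfE// /normal_fun -mulf_div divff ?mul1r; last first.
    by rewrite gt_eqF// normal_peak_gt0.
  by rewrite -expRN -expRD; congr expR; field.
have h0 n x : 0 <= h n x by rewrite hE expR_ge0.
have mh n : measurable_fun [set: measurableTypeR R] (h n).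
  rewrite (_ : h n = fun x =>
      expR (((x - m n) ^+ 2 / s n ^+ 2 - (x - m' n) ^+ 2 / s n ^+ 2) / 2)).
    apply: measurableT_comp => //; apply: measurable_funM => //.
    apply: measurable_funB; apply: measurable_funM => //;
      by apply: measurable_funX; exact: measurable_funB.
  by apply/funext => x; exact: hE.
have mhE n : measurable_fun [set: measurableTypeR R] (fun x => (h n x)%:E).
  exact/measurable_EFinP.
have densE n B : measurable B ->
    normal_prob (m' n) (s n) B =
    (\int[normal_prob (m n) (s n)]_(x in B) (h n x)%:E)%E.
  move=> mB; rewrite [RHS]integral_mkcond ge0_integral_normal//; last 2 first.
  - by apply/(measurable_restrictT _ _).1 => //; exact: measurable_funTS.
  - by move=> x; apply: erestrict_ge0 => // y _; rewrite lee_fin.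
  rewrite /normal_prob [LHS]integral_mkcond; apply: eq_integral => x _.
  rewrite /patch; case: ifP => _; last by rewrite mul0e.
  by rewrite -EFinM divfK// gt_eqF.
have mindA : measurable_fun [set: 'cV[R]_N] (fun v => (\1_A v : R)%:E).
  exact/measurable_EFinP/measurable_indic.
have ind0 v : (0 <= (\1_A v : R)%:E)%E by rewrite lee_fin.
have := product_law_density mh h0 densE Gm G'm' mindA ind0.
rewrite integral_indic// setIT => ->.
rewrite -[X in (G X <= _)%E]setIT -integral_indic//.
apply: ge0_le_integral => //.
- apply: emeasurable_funM => //; apply/measurable_EFinP.
  apply: measurable_prod => n _.
  exact: measurableT_comp (mh n) (measurable_cV_coord n).
- move=> v _; rewrite -EFinM lee_fin indicE.
  have [/set_mem Av|_] := boolP (v \in A); last by rewrite mul0r.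
  rewrite mul1r; under eq_bigr do rewrite hE.
  by rewrite -expR_sum -expR0 ler_expR -mulr_suml sumrB divr_ge0// subr_ge0 Am.
Qed.

Section stack.
Context d (T : measurableType d) (P : probability T R) (N K : nat).
Variables (x : 'I_K -> {mfun T >-> 'cV[R]_N}).

(** Flattening through [mxvec] gives one coordinate per snapshot and feature, so that product laws
    describe all snapshots jointly. *)
Definition stack (w : T) : 'cV[R]_(K * N) :=
  (mxvec (\matrix_(k, n) x k w n 0))^T.

Lemma stackE w k n : stack w (mxvec_index k n) 0 = x k w n 0.
Proof. by rewrite mxE mxvecE mxE. Qed.

Lemma measurable_stack : measurable_fun [set: T] stack.
Proof.
apply: measurable_fun_cV => j; case/mxvec_indexP: j => k n.
rewrite (_ : _ \o _ = cV_coord n \o x k); last first.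
  by apply/funext => w; rewrite /= /cV_coord stackE.
exact: measurableT_comp (measurable_cV_coord n) (measurable_funPT (x k)).
Qed.

HB.instance Definition _ :=
  isMeasurableFun.Build _ _ _ _ stack measurable_stack.

Lemma big_mxvec_index (S : Type) (idx : S) (op : Monoid.com_law idx)
    (F : 'I_(K * N) -> S) :
  \big[op/idx]_j F j = \big[op/idx]_k \big[op/idx]_n F (mxvec_index k n).
Proof.
rewrite pair_bigA (reindex _ (curry_mxvec_bij _ _))/=.
by apply: eq_bigr => -[k n].
Qed.

Lemma stack_product_law (m : 'cV[R]_N) (C : 'M[R]_N) :
  is_diag_mx C -> (forall n, 0 < C n n) ->
  (forall k, is_mvnormal P (x k) m C) -> mutually_independent P x ->
  product_law (distribution P stack)
    (fun j => normal_prob (mxvec (\matrix_(k < K, n < N) m n 0) 0 j)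
                         (mxvec (\matrix_(k < K, n < N) Num.sqrt (C n n)) 0 j)).
Proof.
move=> Cdiag Cpos xmC xindep B mB.
pose A k := cV_rect (fun n => B (mxvec_index k n)).
have mA k : measurable (A k) by exact: measurable_cV_rect.
rewrite -[LHS]/(P (stack @^-1` cV_rect B)).
rewrite (_ : _ @^-1` _ =
    \bigcap_(k in [set` [set: 'I_K]%SET]) x k @^-1` A k); last first.
  apply/seteqP; split => [w wB k _ n|w wA j].
    by have := wB (mxvec_index k n); rewrite /cV_coord stackE.
  case/mxvec_indexP: j => k n; rewrite /cV_coord stackE.
  by apply: (wA k); rewrite /= inE.
rewrite xindep// big_mxvec_index.
apply: eq_big => [k|k _]; first by rewrite inE.
apply: etrans (is_mvnormal_rect Cdiag Cpos (xmC k) (fun=> mB _)) _.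
by apply: eq_bigr => n _; rewrite !mxvecE !mxE.
Qed.

End stack.

End gaussian_vectors.

(** * The barycenter of the stacked snapshots *)

Section fused_snapshots.
Context (R : realType) (N K : nat).

Definition barycenter (z : 'cV[R]_(K * N)) : 'cV[R]_N :=
  \col_n (K%:R^-1 * \sum_(k < K) z (mxvec_index k n) 0).

Lemma measurable_barycenter :
  measurable_fun [set: 'cV[R]_(K * N)] barycenter.
Proof.
apply: measurable_fun_cV => n.
rewrite (_ : _ \o _ = fun z : 'cV[R]_(K * N) =>
    K%:R^-1 * \sum_(k < K) cV_coord (mxvec_index k n) z); last first.
  by apply/funext => z; rewrite /= /cV_coord mxE.
apply: measurable_funM => //; apply: measurable_sum => k.
exact: measurable_cV_coord.
Qed.

Lemma fused_stack d (T : measurableType d)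
    (x : 'I_K -> {mfun T >-> 'cV[R]_N}) w :
  fused x w = barycenter (stack x w).
Proof.
apply/colP => n; rewrite !mxE summxE; congr (_ * _).
by apply: eq_bigr => k _; rewrite stackE.
Qed.

Variables (C : 'M[R]_N).
Hypothesis Cdiag : is_diag_mx C.
Hypothesis Cpos : forall n, 0 < C n n.
Hypothesis K0 : (0 < K)%N.

Let K_neq0 : K%:R != 0 :> R. Proof. by rewrite pnatr_eq0 -lt0n. Qed.

Definition smean (m : 'cV[R]_N) : 'I_(K * N) -> R :=
  fun j => mxvec (\matrix_(k < K, n < N) m n 0) 0 j.

Definition sdev : 'I_(K * N) -> R :=
  fun j => mxvec (\matrix_(k < K, n < N) Num.sqrt (C n n)) 0 j.

Lemma smeanE m k n : smean m (mxvec_index k n) = m n 0.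
Proof. by rewrite /smean mxvecE mxE. Qed.

Lemma sdev_sqr k n : sdev (mxvec_index k n) ^+ 2 = C n n.
Proof. by rewrite /sdev mxvecE mxE sqr_sqrtr// ltW. Qed.

Lemma sdev_neq0 j : sdev j != 0.
Proof.
by case/mxvec_indexP: j => k n; rewrite /sdev mxvecE mxE gt_eqF// sqrtr_gt0.
Qed.

(** Decomposition of inertia: deviations from the barycenter sum to 0 over the snapshots, which
    kills the cross terms. Only the last summand depends on [m]. *)
Lemma sum_sqr_mahalanobis (z : 'cV[R]_(K * N)) (m : 'cV[R]_N) :
  \sum_j (z j 0 - smean m j) ^+ 2 / sdev j ^+ 2 =
  \sum_j (z j 0 - smean (barycenter z) j) ^+ 2 / sdev j ^+ 2 +
  K%:R * mahalanobis C (barycenter z) m.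
Proof.
rewrite mahalanobis_diag// mulr_sumr !big_mxvec_index.
rewrite exchange_big [X in _ = X + _]exchange_big -big_split/=.
apply: eq_bigr => n _; set b := barycenter z.
have sum_dev : \sum_(k < K) (z (mxvec_index k n) 0 - b n 0) = 0.
  rewrite sumrB sumr_const card_ord -mulr_natl !mxE mulrA divff// mul1r.
  exact: subrr.
have -> : K%:R * ((b n 0 - m n 0) ^+ 2 / C n n) =
    \sum_(k < K) ((b n 0 - m n 0) ^+ 2 / C n n).
  by rewrite sumr_const card_ord mulr_natl.
have cross : \sum_(k < K) (z (mxvec_index k n) 0 - b n 0) *
    (2 * (b n 0 - m n 0) / C n n) = 0 by rewrite -mulr_suml sum_dev mul0r.
(* With the vanishing cross term added on the right, the identity holds snapshot by snapshot. *)
rewrite -[RHS]addr0 -[X in _ = _ + X]cross.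
rewrite -!big_split/=; apply: eq_bigr => k _; rewrite !smeanE sdev_sqr; ring.
Qed.

(** * Accuracy and confusion probabilities of the argmin rule *)

Section argmin_classifier.
Context (L : nat) (mu : 'I_L -> 'cV[R]_N).
Context (d : measure_display) (T : measurableType d).
Context (P : 'I_L -> probability T R).
Context (x : 'I_K -> {mfun T >-> 'cV[R]_N}).
Hypothesis xmu : forall l k, is_mvnormal (P l) (x k) (mu l) C.
Hypothesis xindep : forall l, mutually_independent (P l) x.
Context (lhat : 'cV[R]_N -> 'I_L).
Hypothesis lhat_argmin : is_argmin_classifier mu C lhat.

Let decided l := [set w | lhat (fused x w) = l].
Let region l := [set z | lhat (barycenter z) = l].
Let law l : probability 'cV[R]_(K * N) R := distribution (P l) (stack x).

Let law_normal l :
  product_law (law l) (fun j => normal_prob (smean (mu l) j) (sdev j)).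
Proof. exact: stack_product_law. Qed.

Let measurable_region l : measurable (region l).
Proof.
by have := measurable_barycenter measurableT (lhat_argmin.1 l); rewrite setTI.
Qed.

Let decidedE l l' : P l (decided l') = law l (region l').
Proof.
congr (P l _); apply/seteqP.
by split => w; rewrite /decided /region /= fused_stack.
Qed.

Let measurable_decided l : measurable (decided l).
Proof.
rewrite (_ : decided l = stack x @^-1` region l); last first.
  by apply/seteqP; split => w; rewrite /decided /region /= fused_stack.
by have := measurable_stack x measurableT (measurable_region l); rewrite setTI.
Qed.

Let sum_decided l : \sum_(l' < L) fine (P l (decided l')) = 1.
Proof.
apply: EFin_inj; rewrite -sumEFin.
under eq_bigr do rewrite fineK ?fin_num_measure//.
rewrite -[RHS](probability_setT (P l)) -measure_bigsetU_ord//.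
  congr (P l _); rewrite -bigcup_seq; apply/seteqP; split => // w _.
  by exists (lhat (fused x w)); rewrite //= mem_index_enum.
by move=> i j _ _ [w [<- <-]].
Qed.

(** Where the rule answers [l], the centroid of [l] is nearest to the barycenter, so by the inertia
    decomposition the stacked density under [l] dominates the one under [l0]. *)
Lemma prob_correct_ge l l0 :
  (P l0 [set w | lhat (fused x w) = l] <= P l [set w | lhat (fused x w) = l])%E.
Proof.
rewrite -[X in (P l0 X <= _)%E]/(decided l) -[X in (_ <= P l X)%E]/(decided l).
rewrite !decidedE.
apply: le_normal_product sdev_neq0 (law_normal l0) (law_normal l) _ _ => //.
move=> z zl.
rewrite sum_sqr_mahalanobis [leRHS]sum_sqr_mahalanobis lerD2l ler_wpM2l//.
by rewrite -zl; exact: lhat_argmin.2.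
Qed.

(** Each accuracy is at least the probability of the same decision under one fixed class, and those
    probabilities sum to 1. *)
Lemma sum_prob_correct_ge1 : (0 < L)%N ->
  1 <= \sum_(l < L) prob_correct (P l) x lhat l.
Proof.
move=> L0; rewrite -(sum_decided (Ordinal L0)); apply: ler_sum => l _.
apply: fine_le (prob_correct_ge _ _);
  exact: fin_num_measure (measurable_decided l).
Qed.

Lemma prob_confusion_le l l' : 0 < mahalanobis C (mu l) (mu l') ->
  fine (P l [set w | lhat (fused x w) = l']) <=
  gaussQ (Num.sqrt (K%:R * mahalanobis C (mu l) (mu l')) / 2).
Proof.
set g := mahalanobis _ _ _ => g_gt0.
pose delta n := mu l' n 0 - mu l n 0.
(* Coefficients of the expanded difference of the two quadratic forms at the barycenter, see [linE];
   [K%:R] comes from the averaging. Under class [l] this affine form has mean [- g] and variance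
   [4 * g / K%:R]. *)
pose a j := mxvec (\matrix_(k < K, n < N) (2 * delta n / (C n n * K%:R))) 0 j.
pose c := - \sum_n delta n * (mu l' n 0 + mu l n 0) / C n n.
have Cn0 n : C n n != 0 by rewrite gt_eqF.
have aE k n : a (mxvec_index k n) = 2 * delta n / (C n n * K%:R).
  by rewrite /a mxvecE mxE.
have gE : g = \sum_n delta n ^+ 2 / C n n.
  rewrite /g mahalanobis_diag//; apply: eq_bigr => n _.
  by rewrite -sqrrN opprB.
have SE : \sum_j (a j * sdev j) ^+ 2 = 4 * g / K%:R.
  rewrite big_mxvec_index exchange_big gE mulr_sumr mulr_suml.
  apply: eq_bigr => n _; under eq_bigr do rewrite exprMn sdev_sqr aE.
  by rewrite sumr_const card_ord -mulr_natl; field; rewrite K_neq0 Cn0.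
have S_gt0 : 0 < \sum_j (a j * sdev j) ^+ 2.
  by rewrite SE divr_gt0 ?mulr_gt0// ltr0n.
have meanE : c + \sum_j a j * smean (mu l) j = - g.
  rewrite big_mxvec_index exchange_big gE /c -sumrN -big_split/= -sumrN.
  apply: eq_bigr => n _; under eq_bigr do rewrite smeanE aE.
  rewrite sumr_const card_ord -mulr_natl /delta; field.
  by rewrite K_neq0 Cn0.
have linE (z : 'cV[R]_(K * N)) : c + \sum_j a j * z j 0 =
    mahalanobis C (barycenter z) (mu l) - mahalanobis C (barycenter z) (mu l').
  rewrite !mahalanobis_diag// -sumrB big_mxvec_index exchange_big.
  rewrite /c -sumrN -big_split/=.
  apply: eq_bigr => n _; under eq_bigr do rewrite aE.
  rewrite -mulr_sumr !mxE /delta; set s := \sum_(k < K) _; field.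
  by rewrite K_neq0 Cn0.
have mQ : measurable [set z : 'cV[R]_(K * N) | 0 <= c + \sum_j a j * z j 0].
  exact: measurable_halfspace.
have := normal_product_halfspace c sdev_neq0 (law_normal l) S_gt0.
rewrite meanE opprK SE => halfE.
have -> : Num.sqrt (K%:R * g) / 2 = g / Num.sqrt (4 * g / K%:R).
  have S0 : 0 < Num.sqrt (4 * g / K%:R) by rewrite -SE sqrtr_gt0.
  apply: (mulIf (lt0r_neq0 S0)); rewrite divfK; last exact: lt0r_neq0.
  rewrite mulrAC -sqrtrM; last by rewrite mulr_ge0// ltW.
  have -> : K%:R * g * (4 * g / K%:R) = (2 * g) ^+ 2 by field.
  by rewrite sqrtr_sqr gtr0_norm ?mulr_gt0//; field.
rewrite -[leRHS]/(fine (gaussQ _)%:E); apply: fine_le => //.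
  exact: fin_num_measure (measurable_decided l').
(* Answering [l'] forces its centroid to be at least as near as that of [l]; this is only an
   inclusion in the half-space, since a third class may be nearer still. *)
rewrite -halfE -[X in (P l X <= _)%E]/(decided l') decidedE.
apply: le_measure; rewrite ?inE// => z zl'.
by rewrite /= linE subr_ge0 -zl'; exact: lhat_argmin.2.
Qed.

Lemma prob_correct_union_bound (q : R) l :
  (forall l', l' != l -> fine (P l [set w | lhat (fused x w) = l']) <= q) ->
  1 - (L%:R - 1) * q <= prob_correct (P l) x lhat l.
Proof.
move=> Pq; rewrite lerBlDr -[leLHS](sum_decided l) (bigD1 l)//= lerD2l.
apply: le_trans (ler_sum _ (fun l' ll' => Pq l' ll')) _.
rewrite sumr_const cardC1 card_ord.
case: L l {Pq} => [[]//|L' _ /=].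
by rewrite -natr1 addrK mulr_natl.
Qed.

End argmin_classifier.

End fused_snapshots.

(** * The minimal separation and the accuracy bound *)

Lemma g_minP (R : realType) (N L : nat) (mu : 'I_L -> 'cV[R]_N) (C : 'M[R]_N) :
  is_diag_mx C -> (forall n, 0 < C n n) ->
  forall l l', l != l' -> g_min mu C <= mahalanobis C (mu l) (mu l').
Proof.
move=> Cdiag Cpos l l' ll'; rewrite /g_min; set m := (X in fine X).
have m_le : (m <= (mahalanobis C (mu l) (mu l'))%:E)%E.
  exact: (@bigmin_le_cond _ _ _ _ (l, l')).
(* Nonnegative and bounded above by a real, the minimum is finite, so [fine] keeps its value. *)
have m_ge : (0%:E <= m)%E.
  apply: le_bigmin => [|[i j] _ /=]; first exact: leey.
  rewrite lee_fin mahalanobis_diag// sumr_ge0// => n _.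
  by rewrite divr_ge0 ?sqr_ge0// ltW.
by rewrite -lee_fin fineK// (ge0_fin_numE m_ge) (le_lt_trans m_le)// ltry.
Qed.

Theorem proposition1 (R : realType) (N L : nat) (hL : (2 <= L)%N)
    (mu : 'I_L -> 'cV[R]_N) (C : 'M[R]_N)
    (hCdiag : is_diag_mx C) (hCpos : forall n : 'I_N, 0 < C n n)
    (T DS BW : R) (hT : 0 < T) (hDS : 0 < DS) (hBW : 0 < BW)
    (D : nat) (hD : (0 < D)%N)
    (K : nat) (hKms : K%:Z = K_ms T DS BW D) (hK : (1 <= K)%N)
    (xi gamma QB : R) (hxi0 : 0 <= xi) (hxi1 : xi <= 1)
    (hgamma : 0 < gamma) (hQB : 0 < QB)
    (d : measure_display) (Omega : measurableType d)
    (P : 'I_L -> probability Omega R)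
    (x : 'I_K -> {mfun Omega >-> 'cV[R]_N})
    (hnormal : forall (l : 'I_L) (k : 'I_K), is_mvnormal (P l) (x k) (mu l) C)
    (hindep : forall l : 'I_L, mutually_independent (P l) x)
    (lhat : 'cV[R]_N -> 'I_L) (hlhat : is_argmin_classifier mu C lhat) :
  let rho := success_prob xi N D QB gamma in
  let E_ms := sensing_accuracy rho (fun l => prob_correct (P l) x lhat l) in
  (L%:R - 1) * rho *
    Num.max 0 (L%:R^-1 - gaussQ (Num.sqrt (K%:R * g_min mu C) / 2)) + L%:R^-1
  <= E_ms.
Proof.
cbv zeta; set rho := success_prob _ _ _ _ _; set q := gaussQ _.
have L0 : 0 < L%:R :> R by rewrite ltr0n (leq_trans _ hL).
have rho0 : 0 <= rho by rewrite mulr_ge0// subr_ge0 gaussQ_le1.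
rewrite /sensing_accuracy; set pc := \sum_(l < L) _.
have -> : rho / L%:R * pc + (1 - rho) / L%:R =
    rho * (pc / L%:R - L%:R^-1) + L%:R^-1 by field; rewrite gt_eqF.
rewrite lerD2r [leLHS]mulrAC [leLHS]mulrC ler_wpM2l// {rho rho0}.
have [Lq|qL] := leP L%:R^-1 q.
  rewrite max_l ?subr_le0// mulr0 subr_ge0 -[leLHS]mul1r ler_pM2r ?invr_gt0//.
  exact: (sum_prob_correct_ge1 hCdiag hCpos hK hnormal hindep hlhat (ltnW hL)).
rewrite max_r; last by rewrite subr_ge0 ltW.
have g_gt0 : 0 < g_min mu C.
  rewrite ltNge; apply/negP => g_le0.
  have q_half : 2^-1 <= q.
    (* The square root of a nonpositive number is 0, so [q] is the tail at 0, at least 1/2 and hence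
       at least 1/L, against [qL]. *)
    rewrite /q ler0_sqrtr ?mul0r ?gaussQ0_ge// mulr_ge0_le0//.
  have : L%:R^-1 <= 2^-1 :> R by rewrite lef_pV2 ?posrE// ler_nat.
  by move=> /(lt_le_trans qL) /lt_geF; rewrite q_half.
(* Averaging gives 1 - (L - 1) q - 1/L = (L - 1) (1/L - q), the required bound. *)
suff : \sum_(l < L) (1 - (L%:R - 1) * q) <= pc.
  rewrite sumr_const card_ord -[X in X <= _]mulr_natl => pcL.
  rewrite lerBrDr ler_pdivlMr//; apply: le_trans pcL.
  by rewrite le_eqVlt; apply/orP; left; apply/eqP; field; rewrite gt_eqF.
apply: ler_sum => l _.
apply: (prob_correct_union_bound hlhat) => l' l'l.
have gl : g_min mu C <= mahalanobis C (mu l) (mu l').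
  by apply: g_minP => //; rewrite eq_sym.
have l_gt0 := lt_le_trans g_gt0 gl.
apply: le_trans
  (prob_confusion_le hCdiag hCpos hK hnormal hindep hlhat l_gt0) _.
apply: le_gaussQ; rewrite ler_pM2r ?invr_gt0// ler_sqrt ?ler_wpM2l//.
by rewrite mulr_ge0// ltW.
Qed.
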